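(* Let $G$ be a non-archimedean Polish group with a fundamental action $G\curvearrowright\mathbb N$, and consider the Bernoulli shift action of $G$ on $\mathbb R^{\mathbb N}$. Then $G$ is not compact if and only if the $G$-space $\mathbb{R}^{\mathbb N}$ has a $G$-invariant subspace that is generically ergodic with meager orbits.
   Context: A non-archimedean Polish group is a Polish group admitting a neighborhood basis at the identity consisting of open subgroups. Such a group can be written as $G=\mathrm{Aut}(\mathcal N)\subseteq \mathrm{Sym}(\mathbb N)$ for a structure $\mathcal N$ with universe $\mathbb N$ in a countable language, where $\mathrm{Sym}(\mathbb N)$ is the group of all permutations of $\mathbb N$ and the neighborhood basis at the identity can be taken to be the pointwise stabilizers of finite subsets of $\mathbb N$. The resulting action $G\curvearrowright\mathbb N$ is called a fundamental action. The Bernoulli shift for $G$ is the action of $G$ on the space $\mathbb R^{\mathbb N}$ of all maps from $\mathbb N$ to $\mathbb R$ given by $(g\cdot x)(n)=x(g^{-1}(n))$. A $G$-space is generically ergodic if every $G$-invariant Borel subset of it is meager or comeager. ''With meager orbits'' means that every $G$-orbit in the subspace is meager in the subspace.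
   Formalization: The G-invariant subspace is required to be nonempty and Polish in its subspace topology; without this the equivalence fails, e.g. for the trivial group with the empty set or a countable subset without isolated points. *)

(* Defs.v *)
From HB Require Import structures.
From mathcomp Require Import all_boot all_order all_algebra.
From mathcomp Require Import all_classical all_reals all_analysis.

Set Implicit Arguments.
Unset Strict Implicit.
Unset Printing Implicit Defensive.

Import Order.TTheory GRing.Theory Num.Theory.
Import numFieldNormedType.Exports.

Local Open Scope classical_set_scope.

HB.mixin Record isTopologicalGroup G & Group G & Topological G := {
  mulg_continuous : continuous (fun p : G * G => (p.1 * p.2)%g) ;
  invg_continuous : continuous (fun g : G => (g^-1)%g)
}.

#[short(type="topologicalGroupType")]
HB.structure Definition TopologicalGroup :=
  {G of isTopologicalGroup G & Group G & Topological G}.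

Definition separable_space (T : topologicalType) : Prop :=
  exists2 D : set T, countable D & dense D.

Definition is_metric (R : realType) (T : Type) (d : T -> T -> R) : Prop :=
  [/\ forall x y, (0 <= d x y)%R,
      forall x y, d x y = 0%R <-> x = y,
      forall x y, d x y = d y x &
      forall x y z, (d x z <= d x y + d y z)%R].

Definition induces_topology (R : realType) (T : topologicalType)
    (d : T -> T -> R) : Prop :=
  forall (x : T) (A : set T),
    nbhs x A <-> exists2 e : R, (0 < e)%R & [set y | (d x y < e)%R] `<=` A.

Definition is_complete_metric (R : realType) (T : topologicalType)
    (d : T -> T -> R) : Prop :=
  forall u : nat -> T,
    (forall e : R, (0 < e)%R ->
       exists N : nat, forall m n : nat,
         (N <= m)%N -> (N <= n)%N -> (d (u m) (u n) < e)%R) ->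
    exists x : T, u @ \oo --> x.

Definition polish (R : realType) (T : topologicalType) : Prop :=
  separable_space T /\
  exists d : T -> T -> R,
    [/\ is_metric d, induces_topology d & is_complete_metric d].

Definition nowhere_dense (T : topologicalType) (A : set T) : Prop :=
  interior (closure A) = set0.

Definition meager (T : topologicalType) (A : set T) : Prop :=
  exists2 F : nat -> set T,
    (forall n, nowhere_dense (F n)) & A `<=` \bigcup_n F n.

Definition comeager (T : topologicalType) (A : set T) : Prop := meager (~` A).

Definition borel (T : topologicalType) (A : set T) : Prop := <<s @open T >> A.

Definition is_subgroup (G : groupType) (H : set G) : Prop :=
  [/\ H 1%g,
      forall g h, H g -> H h -> H (g * h)%g &
      forall g, H g -> H (g^-1)%g].

Definition nonarchimedean (G : topologicalGroupType) : Prop :=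
  forall U : set G, nbhs (1%g : G) U ->
    exists H : set G, [/\ is_subgroup H, open H & H `<=` U].

Section Actions.
Variables (G : groupType) (T : Type).
Implicit Types (a : G -> T -> T) (A : set T).

Definition is_left_action a : Prop :=
  (forall x, a 1%g x = x) /\ (forall g h x, a (g * h)%g x = a g (a h x)).

Definition invariant_set a A : Prop := forall g x, A x -> A (a g x).

Definition action_orbit a (x : T) : set T := [set a g x | g in [set: G]].

Definition pointwise_stabilizer a A : set G :=
  [set g | forall x, A x -> a g x = x].

Definition sub_action a A (invA : invariant_set a A) (g : G) (x : A) : A :=
  SigSub (mem_set (invA g (set_val x) (set_valP x))).

End Actions.

Definition generically_ergodic (G : groupType) (T : topologicalType)
    (a : G -> T -> T) : Prop :=
  forall A : set T, invariant_set a A -> borel A -> meager A \/ comeager A.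

Definition has_meager_orbits (G : groupType) (T : topologicalType)
    (a : G -> T -> T) : Prop :=
  forall x : T, meager (action_orbit a x).

(* Constants are function symbols of arity 0. *)
Record countable_language := CountableLanguage {
  rel_symbol : countType;
  fun_symbol : countType;
  rel_arity : rel_symbol -> nat;
  fun_arity : fun_symbol -> nat
}.

Record structure_on (T : Type) (L : countable_language) := StructureOn {
  rel_interp : forall r : rel_symbol L, (rel_arity r).-tuple T -> Prop;
  fun_interp : forall f : fun_symbol L, (fun_arity f).-tuple T -> T
}.

Definition automorphism (T : Type) (L : countable_language)
    (N : structure_on T L) (s : T -> T) : Prop :=
  [/\ bijective s,
      forall (r : rel_symbol L) (t : (rel_arity r).-tuple T),
        rel_interp N (map_tuple s t) <-> rel_interp N t &
      forall (f : fun_symbol L) (t : (fun_arity f).-tuple T),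
        fun_interp N (map_tuple s t) = s (fun_interp N t)].

(* The action identifies G, as a topological group, with Aut(N) <= Sym(nat):
   it is faithful, its permutations are exactly the automorphisms of N, and the
   topology of G is that of pointwise convergence on nat. *)
Definition fundamental_action (G : topologicalGroupType)
    (a : G -> nat -> nat) : Prop :=
  [/\ is_left_action a,
      forall g, (forall n, a g n = n) -> g = 1%g,
      exists (L : countable_language) (N : structure_on nat L),
        forall s : nat -> nat, automorphism N s <-> exists g, a g = s &
      forall U : set G, nbhs (1%g : G) U <->
        exists2 F : set nat, finite_set F & pointwise_stabilizer a F `<=` U].

Definition bernoulli_shift (R : realType) (G : groupType)
    (a : G -> nat -> nat) (g : G) (x : {ptws nat -> R}) : {ptws nat -> R} :=
  fun n => x (a (g^-1)%g n).
Arguments bernoulli_shift R {G} a g x.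

(* A subspace of a Polish G-space is again meant to be a Polish space.  This
   cannot be dropped: for trivial G, the empty set and any countable set without
   isolated points are generically ergodic with meager orbits. *)
Definition polish_subspace (R : realType) (T : topologicalType)
    (X : set T) : Prop :=
  X !=set0 /\ polish R X.

(* Main.v *)
Require Import Defs.
From HB Require Import structures.
From mathcomp Require Import all_boot all_order all_algebra.
From mathcomp Require Import all_classical all_reals all_analysis.
From mathcomp Require Import lra.
Import Order.TTheory GRing.Theory Num.Theory.
Import numFieldNormedType.Exports.

Set Implicit Arguments.
Unset Strict Implicit.
Unset Printing Implicit Defensive.

Local Open Scope classical_set_scope.

(** The dividing line is whether all orbits of [G] on [nat] are finite.

    If they are, [G] is compact: along an ultrafilter on [G] each value [a g n]
    and each value [a g^-1 n] is eventually constant, because it stays in a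
    finite set, and the limit permutation is again an automorphism, because
    being one only involves finitely many values at a time
    ([compact_of_finite_orbits]).

    So if [G] is not compact, some orbit [O] on [nat] is infinite, and the
    subspace wanted is that of the [x] vanishing off [O], a copy of the product
    of countably many real lines.  By Neumann's separation lemma
    ([neumann_separation]) some element of [G] moves any given finite part of
    [O] off any other one; since a basic open set only restricts finitely many
    values, every nonempty open set has a translate meeting any other one
    ([shift_transitive]).  A Borel set agrees with an open set up to a meager
    set, so by the Baire category theorem topological transitivity gives generic
    ergodicity ([transitive_generically_ergodic]).  Orbits are meager because
    all points of the orbit of [x] take at a fixed place of [O] a value from the
    countable range of [x].

    Conversely, let [G] be compact, acting with meager orbits on a nonempty
    Polish subspace.  By the Baire category theorem there are at least two
    orbits.  By compactness, two points in different orbits have neighborhoods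
    whose saturations are disjoint ([orbits_separated]); these saturations are
    invariant, open and nonempty, hence nonmeager, and as they are disjoint
    neither is comeager.  So the action is not generically ergodic
    ([compact_not_generically_ergodic]). *)

(** * Baire category *)

Section Category.
Variable T : topologicalType.
Implicit Types A B U V : set T.

(** A form without closures and interiors, which passes through homeomorphisms
    and turns into nested balls in the category theorem. *)
Lemma nowhere_denseP A : nowhere_dense A <->
  forall U, open U -> U !=set0 ->
    exists V, [/\ open V, V !=set0, V `<=` U & V `&` A = set0].
Proof.
split=> [ndA U oU [x Ux]|ndA].
  exists (U `\` closure A); split.
  - by apply: openI => //; exact/closed_openC/closed_closure.
  - apply: contrapT => /nonemptyPn UA0.
    suff : interior (closure A) x by rewrite ndA.
    rewrite /interior nbhsE; exists U => // y Uy; apply: contrapT => nAy.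
    by have : set0 y by rewrite -UA0.
  - exact: subIsetl.
  - by rewrite -subset0 => y [[_ nAy] /subset_closure].
rewrite /nowhere_dense -subset0 => x Ax.
have [|V [oV [y Vy] VA VA0]] := ndA _ (@open_interior _ (closure A)).
  by exists x.
have /interior_subset clAy := VA _ Vy.
have [z [Az Vz]] := clAy _ (open_nbhs_nbhs (conj oV Vy)).
by have : set0 z by rewrite -VA0.
Qed.

Lemma meagerS A B : A `<=` B -> meager B -> meager A.
Proof. by move=> AB [F ndF BF]; exists F => //; exact: subset_trans BF. Qed.

Lemma nowhere_dense_meager A : nowhere_dense A -> meager A.
Proof. by move=> ndA; exists (fun=> A) => // x Ax; exists 0%N. Qed.

Lemma meager_set0 : meager (@set0 T).
Proof.
by apply: nowhere_dense_meager; rewrite /nowhere_dense closure0 interior0.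
Qed.

Lemma meager_bigcup (F : nat -> set T) :
  (forall n, meager (F n)) -> meager (\bigcup_n F n).
Proof.
move=> mF.
have /choice[E EP] n : exists E : nat -> set T,
    (forall k, nowhere_dense (E k)) /\ F n `<=` \bigcup_k E k.
  by have [E ndE FE] := mF n; exists E.
exists (fun m => if unpickle m is Some (n, k) then E n k else set0).
  move=> m; case: unpickle => [[n k]|]; first by have [] := EP n.
  by rewrite /nowhere_dense closure0 interior0.
move=> x [n _ Fx]; have [k _ Ex] := (EP n).2 _ Fx.
by exists (pickle (n, k)); rewrite // pickleK.
Qed.

Lemma meagerU A B : meager A -> meager B -> meager (A `|` B).
Proof.
move=> mA mB; apply: meagerS (_ : _ `<=` \bigcup_n (if n is 0%N then A else B)) _.
  by move=> x [Ax|Bx]; [exists 0%N|exists 1%N].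
by apply: meager_bigcup => -[].
Qed.

Lemma nowhere_dense_boundary U : open U -> nowhere_dense (closure U `\` U).
Proof.
move=> oU; apply/nowhere_denseP => V oV [x Vx].
have [UV0|/set0P UV] := eqVneq (V `&` U) set0.
  exists V; split => //; first by exists x.
  rewrite -subset0 => y [Vy [clUy _]].
  have [z [Uz Vz]] := clUy _ (open_nbhs_nbhs (conj oV Vy)).
  by have : set0 z by rewrite -UV0.
exists (V `&` U); split; [exact: openI|by []|exact: subIsetl|].
by rewrite -subset0 => y [[_ Uy] [_ nUy]].
Qed.

Definition baire_property A :=
  exists2 U, open U & meager ((A `\` U) `|` (U `\` A)).

(** The complement of an open set [U] differs from the interior of that
    complement only by the boundary of [U], which is nowhere dense. *)
Lemma baire_propertyC A : baire_property A -> baire_property (~` A).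
Proof.
move=> [U oU mAU]; exists (~` closure U).
  exact/closed_openC/closed_closure.
have mb := nowhere_dense_meager (nowhere_dense_boundary oU).
apply: meagerS (meagerU mAU mb) => x.
have [Ux|nUx] := pselect (U x); have [cx|ncx] := pselect (closure U x);
  have [Ax|nAx] := pselect (A x) => /=; try tauto.
by move: (subset_closure Ux) => /ncx.
Qed.

Lemma baire_property_bigcup (F : nat -> set T) :
  (forall n, baire_property (F n)) -> baire_property (\bigcup_n F n).
Proof.
move=> bF.
have /choice[U UP] n : exists U : set T,
    open U /\ meager ((F n `\` U) `|` (U `\` F n)).
  by have [U oU mU] := bF n; exists U.
exists (\bigcup_n U n); first by apply: bigcup_open => n _; have [] := UP n.
apply: meagerS (meager_bigcup (fun n => (UP n).2)) => x [] [[n _ Fx] nUx].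
  by exists n => //; left; split => // Ux; apply: nUx; exists n.
by exists n => //; right; split => // Ux; apply: nUx; exists n.
Qed.

(** Sets with the Baire property form a sigma-algebra containing the open
    sets. *)
Lemma borel_baire_property A : borel A -> baire_property A.
Proof.
move: A; apply: smallest_sub; last first.
  by move=> U oU; exists U => //; rewrite !setDv setU0; exact: meager_set0.
split.
- by exists set0; [exact: open0|rewrite !setDv setU0; exact: meager_set0].
- by move=> A; rewrite setTD; exact: baire_propertyC.
- exact: baire_property_bigcup.
Qed.

Lemma borel_open U : open U -> borel U.
Proof. exact: sub_gen_smallest. Qed.

End Category.

Lemma meager_preimage (S T : topologicalType) (f : S -> T) (g : T -> S) A :
  continuous f -> continuous g -> cancel f g -> cancel g f ->
  meager A -> meager (f @^-1` A).
Proof.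
move=> cf cg fK gK [F ndF AF]; exists (fun n => f @^-1` F n); last first.
  by move=> x /AF[n _ Fx]; exists n.
move=> n; apply/nowhere_denseP => U oU [x Ux].
have [//||V [oV [y Vy] VU VF0]] := (nowhere_denseP (F n)).1 (ndF n) (g @^-1` U).
- by move/continuousP: cg; apply.
- by exists (f x); rewrite /preimage/= fK.
exists (f @^-1` V); split.
- by move/continuousP: cf; apply.
- by exists (g y); rewrite /preimage/= gK.
- by move=> z /VU; rewrite /preimage/= fK.
- by rewrite -preimage_setI VF0 preimage_set0.
Qed.

(** * Topological transitivity and generic ergodicity *)

Section ActionInverse.
Variables (G : groupType) (T : Type) (a : G -> T -> T).
Hypothesis aP : is_left_action a.

Lemma act_invK g : cancel (a g) (a g^-1%g).
Proof. by move=> x; rewrite -aP.2 mulVg aP.1. Qed.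

Lemma act_invKV g : cancel (a g^-1%g) (a g).
Proof. by move=> x; rewrite -aP.2 mulgV aP.1. Qed.

End ActionInverse.

Section GenericErgodicity.
Variables (G : groupType) (T : topologicalType) (a : G -> T -> T).
Hypothesis aP : is_left_action a.
Hypothesis a_cont : forall g, continuous (a g).
Hypothesis T_baire : forall U : set T, open U -> U !=set0 -> ~ meager U.

(** Suppose that neither an invariant Borel set [A] nor its complement is
    meager.  Then [A] is comeager in some nonempty open [U], and its complement in
    some nonempty open [V].  Some [g] carries a point of [U] into [V], so that the
    nonempty open set of those points of [U] that [g] sends into [V] would be
    meager: a point of it outside a meager set lies in [A], while its image
    under [g] does not. *)
Lemma transitive_generically_ergodic :
  (forall U V : set T, open U -> open V -> U !=set0 -> V !=set0 ->
     exists g x, U x /\ V (a g x)) ->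
  generically_ergodic a.
Proof.
move=> trans A invA /borel_baire_property bA.
have [V oV mAV] := baire_propertyC bA; have [U oU mAU] := bA.
have [U0|U0] := pselect (U !=set0); last first.
  left; apply: meagerS mAU => x Ax; left; split => // Ux.
  by apply: U0; exists x.
have [V0|V0] := pselect (V !=set0); last first.
  right; apply: meagerS mAV => x Ax; left; split => // Vx.
  by apply: V0; exists x.
have [g [x [Ux Vx]]] := trans _ _ oU oV U0 V0; exfalso.
have oW : open (U `&` a g @^-1` V).
  by apply: openI => //; move/continuousP: (@a_cont g); apply.
apply: (T_baire oW); first by exists x.
have := meagerU mAU (meager_preimage (@a_cont g) (@a_cont g^-1%g)
  (act_invK aP g) (act_invKV aP g) mAV).
apply: meagerS => y [Uy Vy].
have [Ay|nAy] := pselect (A y); last by left; right.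
by right; right; split => //; rewrite /setC/= => nA; apply: nA; exact: invA.
Qed.

End GenericErgodicity.

(** * The Baire category theorem for Polish spaces *)

Section PolishBaire.
Variables (R : realType) (T : topologicalType).
Local Open Scope ring_scope.

(** Closed balls are nested inside [U], the (k+1)-st one avoiding the k-th
    nowhere dense set and having radius at most 1/(k+1); their centers form a
    Cauchy sequence, whose limit lies in [U] and in none of these sets. *)
Lemma polish_baire : polish R T ->
  forall U : set T, open U -> U !=set0 -> ~ meager U.
Proof.
move=> [_ [d [[d_ge0 d0 dC dD] d_top d_cmp]]] U oU [x0 Ux0] [F ndF UF].
have oball x r : open [set y | d x y < r].
  rewrite openE => y /= dxy; apply/d_top; exists (r - d x y); first by rewrite subr_gt0.
  by move=> z /= dyz; apply: le_lt_trans (dD x y z) _; rewrite -ltrBrDl.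
have dxx x : d x x = 0 by apply/d0.
have shrink (V : set T) (k : nat) x : open V -> V x ->
    exists2 r, 0 < r <= k.+1%:R^-1 & [set y | d x y <= r] `<=` V.
  move=> oV Vx; have /d_top[e e0 eV] : nbhs x V by exact: open_nbhs_nbhs.
  exists (Num.min (e / 2) k.+1%:R^-1).
    by rewrite lt_min divr_gt0//= invr_gt0 ltr0n/= ge_min lexx orbT.
  move=> y /=; rewrite le_min => /andP[dy _]; apply: eV => /=.
  by apply: le_lt_trans dy _; rewrite ltr_pdivrMr// mulr2n mulrDr mulr1 ltrDl.
have [r0 /andP[r0_gt0 r0_le] r0U] := shrink U 0%N x0 oU Ux0.
have step (k : nat) (p : T * R) : exists q : T * R, 0 < p.2 ->
    [/\ 0 < q.2 <= k.+1%:R^-1,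
        [set y | d q.1 y <= q.2] `<=` [set y | d p.1 y <= p.2] &
        [set y | d q.1 y <= q.2] `&` F k = set0].
  have [p0|] := pselect (0 < p.2); last by exists p.
  have [//||V [oV [y Vy] Vp VF0]] :=
    (nowhere_denseP (F k)).1 (ndF k) [set y | d p.1 y < p.2].
    by exists p.1; rewrite /= dxx.
  have [r r_k rV] := shrink V k y oV Vy; exists (y, r); split => //=.
    by move=> z /rV/Vp /ltW.
  by rewrite -subset0 -VF0 => z [/rV].
have /choice[s sP] : forall kp : nat * (T * R), exists q : T * R, 0 < kp.2.2 ->
    [/\ 0 < q.2 <= kp.1.+1%:R^-1,
        [set y | d q.1 y <= q.2] `<=` [set y | d kp.2.1 y <= kp.2.2] &
        [set y | d q.1 y <= q.2] `&` F kp.1 = set0].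
  by move=> [k p]; exact: step.
pose p := fix p n := if n is k.+1 then s (k, p k) else (x0, r0).
have p_gt0 n : 0 < (p n).2.
  by elim: n => //= n IH; have [/andP[]] := sP (n, p n) IH.
have p_le n : (p n.+1).2 <= n.+1%:R^-1.
  by have [/andP[]] := sP (n, p n) (p_gt0 n).
have p_sub m n : (m <= n)%N ->
    [set y | d (p n).1 y <= (p n).2] `<=` [set y | d (p m).1 y <= (p m).2].
  move=> /subnKC <-; elim: (n - m)%N => [|k IH]; first by rewrite addn0.
  rewrite addnS; apply: subset_trans IH.
  by have [_ + _] := sP (m + k, p (m + k))%N (p_gt0 _).
have p_mem m n : (m <= n)%N -> d (p m).1 (p n).1 <= (p m).2.
  by move=> mn; apply: (p_sub _ _ mn); rewrite /= dxx ltW.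
have [e e0|x ux] := d_cmp (fun n => (p n).1).
  have [N _ NP] := near_infty_natSinv_lt (PosNum (divr_gt0 e0 (ltr0n R 2))).
  exists N.+1 => m n Nm Nn; apply: le_lt_trans (dD _ (p N.+1).1 _) _.
  have {NP} := NP N (leqnn _); rewrite /= => NP.
  (* All later centers lie in the closed ball around the (N+1)-st one, whose
     radius is at most 1/(N+1). *)
  have near_p k : (N.+1 <= k)%N -> d (p N.+1).1 (p k).1 < e / 2.
    by move=> Nk; apply: le_lt_trans (p_mem _ _ Nk) _; apply: le_lt_trans (p_le N) _.
  by rewrite (splitr e) ltrD ?near_p// dC near_p.
have x_in n : d (p n).1 x <= (p n).2.
  apply/ler_addgt0Pr => e e0.
  have : nbhs x [set y | d x y < e] by apply/d_top; exists e.
  move=> /ux[N _ NP].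
  apply: le_trans (dD _ (p (maxn n N)).1 _) _; apply: lerD.
    by apply: p_mem; exact: leq_maxl.
  by rewrite dC; apply: ltW; apply: NP; exact: leq_maxr.
have [k _ Fk] : (\bigcup_n F n) x by apply: UF; apply: r0U; exact: (x_in 0%N).
have [_ _ FK] := sP (k, p k) (p_gt0 k).
by have : set0 x by rewrite -FK; split => //; exact: (x_in k.+1).
Qed.

End PolishBaire.

(** * Neumann's separation lemma *)

(** Induction on [F], after the proof that a group covered by finitely many
    cosets of subgroups is covered by the cosets of those of finite index.  As the
    orbit of the first point [f] is infinite, some [h] sends [f] outside [D].  Any
    [d] in [D] in the orbit of [f] is reached from [a h f] by some [k d].  Choose
    [g] moving the rest of [F] off [D] and off all the translates of [D] by the
    [k d].  If [g] still sends [f] to some [d] in [D], then the inverse of [k d]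
    times [g] sends [f] to [a h f] and the rest of [F] off [D]. *)
Lemma neumann_separation (G : groupType) (T : choiceType) (a : G -> T -> T)
    (F D : seq T) : is_left_action a ->
  (forall x, x \in F -> infinite_set (action_orbit a x)) ->
  exists g, forall x, x \in F -> a g x \notin D.
Proof.
move=> aP; elim: F D => [|f F IH] D infF; first by exists 1%g.
have [h hf] : exists h, a h f \notin D.
  apply: contrapT => nh; apply: (infF f (mem_head _ _)).
  apply: sub_finite_set (finite_seq D) => _ [h _ <-] /=.
  by apply: contrapT => /negP hf; apply: nh; exists h.
have /choice[k kP] d : exists k, action_orbit a f d -> a k (a h f) = d.
  have [[u _ ufd]|] := pselect (action_orbit a f d); last by exists 1%g.
  by exists (u * h^-1)%g => _; rewrite -!aP.2 -mulgA mulVg mulg1.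
have [|g gF] := IH (D ++ [seq a (k d) e | d <- D, e <- D]).
  by move=> x xF; apply: infF; rewrite inE xF orbT.
have [gfD|gfD] := boolP (a g f \in D); last first.
  exists g => x; rewrite inE => /predU1P[->//|/gF].
  by rewrite mem_cat negb_or => /andP[].
have kE : a (k (a g f)) (a h f) = a g f by apply: kP; exists g.
exists ((k (a g f))^-1 * g)%g => x; rewrite inE => /predU1P[->|/gF].
  by rewrite aP.2 -[X in a _ X]kE (act_invK aP).
apply: contra; rewrite aP.2 mem_cat => xD; apply/orP; right.
apply/allpairsP; exists (a g f, a (k (a g f))^-1%g (a g x)).
by rewrite /= (act_invKV aP).
Qed.

(** * Groups with finite orbits are compact *)

Lemma ultra_finite_value (S : Type) (T : eqType) (F : set_system S) (f : S -> T)
    (s : seq T) : UltraFilter F -> F [set x | f x \in s] ->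
  exists y, F [set x | f x = y].
Proof.
move=> FU; elim: s => [|y s IH] Fs.
  by have [x] := filter_ex Fs.
have [Fy|Fny] := in_ultra_setVsetC [set x | f x = y] FU; first by exists y.
apply: IH; apply: filterS (filterI Fs Fny) => x /=.
by rewrite inE => -[/predU1P[]].
Qed.

Section Fundamental.
Variables (G : topologicalGroupType) (a : G -> nat -> nat).
Hypothesis a_fund : fundamental_action a.

Let aP : is_left_action a. Proof. by case: a_fund. Qed.

Lemma mulg_left_continuous (h : G) : continuous (fun g : G => (h * g)%g).
Proof.
move=> g; apply: (@continuous_comp _ _ _ (fun g : G => (h, g)) (fun p => (p.1 * p.2)%g)).
  by apply: cvg_pair; [exact: cvg_cst|exact: cvg_id].
exact: mulg_continuous.
Qed.

(** The topology of pointwise convergence at an arbitrary element of [G],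
    obtained by translation from the neighborhoods of the identity. *)
Lemma nbhs_fundamentalP (g0 : G) (U : set G) : nbhs g0 U <->
  exists s : seq nat, forall g, (forall n, n \in s -> a g n = a g0 n) -> U g.
Proof.
have [_ _ _ nbhs1P] := a_fund; split.
  move=> g0U.
  have : nbhs (1%g : G) [set g | U (g0 * g)%g].
    by apply: (@mulg_left_continuous g0 1%g); rewrite mulg1.
  move=> /nbhs1P[F /finite_seqP[s ->] sU]; exists s => g gs.
  rewrite -(mulVKg g0 g); apply: sU => n /gs gn.
  by rewrite aP.2 gn (act_invK aP).
move=> [s sU].
have : nbhs (1%g : G) [set g | U (g0 * g)%g].
  apply: (nbhs1P [set g | U (g0 * g)%g]).2; exists [set` s]; first exact: finite_seq.
  by move=> g gs; apply: sU => n ns; rewrite aP.2 (gs n ns).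
rewrite -(mulVg g0) => /(@mulg_left_continuous g0^-1%g g0) U0.
have {U0} : nbhs g0 [set g | U (g0 * (g0^-1 * g))%g] by exact: U0.
by rewrite (_ : [set g | _] = U)//; apply/seteqP; split => g /=; rewrite mulVKg.
Qed.

(** An ultrafilter on [G] picks out a value [s n] of [a g n] and a value [t n]
    of [a g^-1 n] for each [n].  The maps [s] and [t] are mutually inverse, and on
    every finite set [s] agrees with an element of [G]; as each instance of a
    relation or function of the structure involves finitely many points, [s] is
    an automorphism, and the ultrafilter converges to the element inducing it. *)
Lemma compact_of_finite_orbits :
  (forall n, finite_set (action_orbit a n)) -> compact [set: G].
Proof.
move=> finO; rewrite compact_ultra => F FU _.
have [_ _ [L [N autN]] _] := a_fund.
have /choice[s sP] n : exists m, F [set g | a g n = m].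
  have /finite_seqP[l lE] := finO n.
  apply: (@ultra_finite_value _ _ _ (a^~ n) l) => //.
  by apply: filterE => g; suff : [set` l] (a g n) by []; rewrite -lE; exists g.
have /choice[t tP] n : exists m, F [set g | a g^-1%g n = m].
  have /finite_seqP[l lE] := finO n.
  apply: (@ultra_finite_value _ _ _ (fun g => a g^-1%g n) l) => //.
  by apply: filterE => g; suff : [set` l] (a g^-1%g n) by []; rewrite -lE; exists g^-1%g.
have Fl (l : seq nat) : F [set g | forall n, n \in l -> a g n = s n].
  elim: l => [|n l IH]; first exact: filterE.
  apply: filterS (filterI (sP n) IH) => g [gn gl] m.
  by rewrite inE => /predU1P[->|/gl].
have sl (l : seq nat) : exists g, forall n, n \in l -> a g n = s n.
  by have [g gl] := filter_ex (Fl l); exists g.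
have aut_s : automorphism N s.
  have autg g : automorphism N (a g) by apply/autN; exists g.
  split.
  - exists t => n.
      have [g [/= gn gsn]] := filter_ex (filterI (sP n) (tP (s n))).
      by rewrite -gsn -gn (act_invK aP).
    have [g [/= gn gtn]] := filter_ex (filterI (tP n) (sP (t n))).
    by rewrite -gtn -gn (act_invKV aP).
  - move=> r u; have [g gu] := sl u; have [_ /(_ r u) + _] := autg g.
    congr (rel_interp N _ <-> _); apply/val_inj/eq_in_map => n nu.
    exact: gu.
  - move=> f u; have [g gu] := sl (fun_interp N u :: u).
    have [_ _ /(_ f u)] := autg g; rewrite gu ?mem_head// => <-.
    congr (fun_interp N _); apply/val_inj/eq_in_map => n nu.
    by rewrite gu// inE nu orbT.
have [g0 g0s] := (autN s).1 aut_s; exists g0; split => // U /nbhs_fundamentalP[l lU].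
by apply: filterS (Fl l) => g gl; apply: lU; rewrite g0s.
Qed.

End Fundamental.

(** * The topology of subspaces of the Bernoulli shift *)

Section Cylinders.
Variables (R : realType) (X : set {ptws nat -> R}).
Local Open Scope ring_scope.

Definition cylinder (x : X) (N : nat) (e : R) : set X :=
  [set y | forall n, (n < N)%N -> `|set_val x n - set_val y n| < e].

Lemma value_continuous (n : nat) : continuous (fun y : X => set_val y n).
Proof.
move=> y; apply: (@continuous_comp _ _ _ (set_val : X -> _) (fun f => f n)).
  exact: initial_continuous.
exact: (@proj_continuous _ (fun=> R) n).
Qed.

Lemma nbhs_cylinder (x : X) N (e : R) : 0 < e -> nbhs x (cylinder x N e).
Proof.
move=> e0; elim: N => [|N IH]; first exact: filterE.
have xN : nbhs x [set y | `|set_val x N - set_val y N| < e].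
  exact: (@value_continuous N x) (nbhsx_ballx (set_val x N) e e0).
apply: filterS (filterI IH xN) => y [/= yN yNN] n.
by rewrite ltnS leq_eqVlt => /predU1P[->//|]; exact: yN.
Qed.

(** The cylinders form a filter that converges to [x], as it does so at each
    place; hence it is finer than the neighborhood filter of [x]. *)
Lemma nbhs_cylinderP (x : X) (A : set X) :
  nbhs x A <-> exists N e, 0 < e /\ cylinder x N e `<=` A.
Proof.
split; last first.
  by move=> [N [e [e0 eA]]]; apply: filterS eA _; exact: nbhs_cylinder.
pose F := filter_from [set p : nat * R | 0 < p.2] (fun p => cylinder x p.1 p.2).
have FF : Filter F.
  apply: filter_from_filter; first by exists (0%N, 1); exact: ltr01.
  move=> [M d] [N e] /= d0 e0; exists (maxn M N, Num.min d e).
    by rewrite /= lt_min d0.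
  move=> y yMN; split => n nb; have := yMN n; rewrite /= lt_min leq_max nb ?orbT;
  by move=> /(_ isT)/andP[].
suff Fx : F --> x by move=> /Fx[[N e] /= e0 NA]; exists N, e.
(* The subspace has the initial topology for the inclusion, and the product the
   supremum of the initial topologies for the evaluations. *)
suff Fx : set_val @ F --> set_val x.
  by move=> B [_ [[W oW <-] Wx] /filterS]; apply; apply: Fx; exact: open_nbhs_nbhs.
apply/cvg_sup => i B [_ [[V oV <-] Vx] /filterS]; apply.
have /nbhs_ballP[e /= e0 eV] : nbhs (set_val x i) V by exact: open_nbhs_nbhs.
by exists (i.+1, e) => // y ye; apply: eV; exact: ye.
Qed.

End Cylinders.

(** * Invariant subspaces under a compact group *)

Section ShiftTopology.
Variables (R : realType) (G : topologicalGroupType) (a : G -> nat -> nat).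
Hypothesis a_fund : fundamental_action a.
Variables (X : set {ptws nat -> R}) (invX : invariant_set (bernoulli_shift R a) X).
Local Open Scope ring_scope.

Let aP : is_left_action a. Proof. by case: a_fund. Qed.

Lemma sub_shiftE g (x : X) n :
  set_val (sub_action invX g x) n = set_val x (a (g^-1)%g n).
Proof. by []. Qed.

Lemma sub_shift_action : is_left_action (sub_action invX).
Proof.
split=> [x|g h x]; apply: val_inj; apply/funext => n.
  by rewrite -!set_valE sub_shiftE invg1 aP.1.
by rewrite -!set_valE !sub_shiftE invgM aP.2.
Qed.

Lemma sub_shift_continuous g : continuous (sub_action invX g).
Proof.
move=> x A /nbhs_cylinderP[N [e [e0 NA]]].
pose M := \max_(n < N) (a (g^-1)%g n).+1.
apply: (nbhs_cylinderP x (sub_action invX g @^-1` A)).2.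
exists M, e; split => // y yM; apply: NA => n nN.
by rewrite !sub_shiftE; apply: yM; exact: (leq_bigmax (Ordinal nN)).
Qed.

(** For [g] fixed, the translate of [y] by [g] differs from [x] at some place.
    There the translate of [v] by [g'] still differs from [u], for [g'] near [g] and
    [(u, v)] near [(x, y)]: the element [g'] only has to act like [g] on one
    natural number.  Compactness of [G] makes the neighborhood of [(x, y)]
    independent of [g]. *)
Lemma orbits_separated (x y : X) : compact [set: G] ->
  ~ action_orbit (sub_action invX) y x ->
  exists U V : set X, [/\ open U, open V, U x, V y &
    forall g u v, U u -> V v -> sub_action invX g v <> u].
Proof.
move=> cG nyx.
have : \forall p \near (x, y), [set: G] `<=` [set g | sub_action invX g p.2 <> p.1].
  apply: ((compact_near_coveringP _).1 cG (X * X)%type (nbhs (x, y))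
    (fun p g => sub_action invX g p.2 <> p.1)) => g _.
  have [n ngx] : exists n, set_val x n <> set_val y (a (g^-1)%g n).
    apply: contrapT => /forallNP gx; apply: nyx; exists g => //.
    apply: val_inj; apply/funext => n; rewrite -!set_valE sub_shiftE.
    exact: esym (contrapT (gx n)).
  set m := a (g^-1)%g n in ngx.
  pose r := `|set_val x n - set_val y m| / 2.
  have r0 : 0 < r by rewrite divr_gt0// normr_gt0 subr_eq0; apply/eqP.
  exists ([set g' | a g' m = n],
          [set p : X * X | `|set_val x n - set_val p.1 n| < r /\
                           `|set_val y m - set_val p.2 m| < r]) => /=.
    split.
      apply/(nbhs_fundamentalP a_fund); exists [:: m] => g' gm /=; rewrite gm ?mem_head//.
      exact: (act_invKV aP).
    exists ([set u | `|set_val x n - set_val u n| < r],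
            [set v | `|set_val y m - set_val v m| < r]) => //=; split.
      exact: (@value_continuous _ _ n x) (nbhsx_ballx _ r r0).
    exact: (@value_continuous _ _ m y) (nbhsx_ballx _ r r0).
  move=> [g' [u v]] /= [g'm [xu yv]] gvu; move: xu; rewrite -gvu sub_shiftE.
  rewrite (_ : a g'^-1%g n = m); last by rewrite -g'm (act_invK aP).
  move=> xv.
  suff : `|set_val x n - set_val y m| < `|set_val x n - set_val y m|.
    by rewrite ltxx.
  rewrite [ltRHS](splitr _).
  apply: le_lt_trans (ler_distD (set_val v m) _ _) _.
  by rewrite ltrD// distrC.
move=> [[U V] /= [Ux Vy] UV]; exists (interior U), (interior V).
split=> //; [exact: open_interior|exact: open_interior|].
move=> g u v /interior_subset Uu /interior_subset Vv.
exact: (UV (u, v) (conj Uu Vv) g I).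
Qed.

(** The saturations of the neighborhoods that separate two orbits are disjoint,
    invariant, open and nonmeager. *)
Lemma compact_not_generically_ergodic : compact [set: G] ->
  polish_subspace R X -> has_meager_orbits (sub_action invX) ->
  ~ generically_ergodic (sub_action invX).
Proof.
move=> cG [[x0 Xx0] pX] mo erg.
have baireX := polish_baire pX.
pose b := sub_action invX; pose y : X := SigSub (mem_set Xx0).
(* Otherwise the space would be one orbit, and meager in itself. *)
have [x nyx] : exists x, ~ action_orbit b y x.
  apply: contrapT => /forallNP yT.
  apply: (baireX setT); [exact: openT|by exists y|].
  by apply: meagerS (mo y) => x _; exact: contrapT (yT x).
have [U [V [oU oV Ux Vy UV]]] := orbits_separated cG nyx.
have bP : is_left_action b := sub_shift_action.
pose sat W : set X := \bigcup_g b g @^-1` W.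
have osat W : open W -> open (sat W).
  move=> oW; apply: bigcup_open => g _.
  by move/continuousP: (@sub_shift_continuous g); apply.
have subsat W : W `<=` sat W.
  by move=> z Wz; exists 1%g => //; rewrite /preimage/= bP.1.
have invsat W : invariant_set b (sat W).
  move=> g z [h _ Whz]; exists (h * g^-1)%g => //.
  by rewrite /preimage/= -bP.2 -mulgA mulVg mulg1.
have disj : sat V `<=` ~` sat U.
  move=> z [g _ Vgz] [h _ Uhz]; apply: (UV (h * g^-1)%g _ _ Uhz Vgz).
  by rewrite -/b -bP.2 -mulgA mulVg mulg1.
case: (erg (sat U) (invsat U) (borel_open (osat _ oU))).
  by apply: baireX; [exact: osat|exists x; exact: subsat].
move=> /(meagerS disj).
by apply: baireX; [exact: osat|exists y; exact: subsat].
Qed.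

End ShiftTopology.

(** * A complete metric on sequences *)

Section SupDistance.
Variable R : realType.
Implicit Types x y z : nat -> R.
Local Open Scope ring_scope.

(** The cut-offs 1/(n+1) make nearness in this distance a condition on finitely
    many places only. *)
Definition sup_dist x y : R :=
  sup (range (fun n => Num.min n.+1%:R^-1 `|x n - y n|)).

Lemma sup_dist_le x y (c : R) :
  (forall n, Num.min n.+1%:R^-1 `|x n - y n| <= c) -> sup_dist x y <= c.
Proof.
move=> xyc; apply: ge_sup.
  by exists (Num.min 1%:R^-1 `|x 0%N - y 0%N|); exists 0%N.
by move=> _ [n _ <-].
Qed.

Lemma sup_dist_ge x y n : Num.min n.+1%:R^-1 `|x n - y n| <= sup_dist x y.
Proof.
apply: ub_le_sup; last by exists n.
exists 1 => _ [m _ <-]; rewrite ge_min; apply/orP; left.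
by rewrite invf_le1// ler1n.
Qed.

Lemma sup_dist_ge0 x y : 0 <= sup_dist x y.
Proof.
apply: le_trans (sup_dist_ge x y 0%N).
by rewrite le_min normr_ge0 invr_ge0 ler0n.
Qed.

Lemma sup_distC x y : sup_dist x y = sup_dist y x.
Proof. by rewrite /sup_dist; under eq_fun do rewrite distrC. Qed.

Lemma sup_dist_coord x y n : sup_dist x y < n.+1%:R^-1 ->
  `|x n - y n| <= sup_dist x y.
Proof.
move=> xyn; have := sup_dist_ge x y n.
by rewrite ge_min => /orP[|//]; rewrite leNgt xyn.
Qed.

Lemma sup_dist0P x y : sup_dist x y = 0 <-> x = y.
Proof.
split=> [xy0|->].
  apply/funext => n; apply/eqP; rewrite -subr_eq0 -normr_le0 -xy0.
  by apply: sup_dist_coord; rewrite xy0 invr_gt0 ltr0n.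
apply/eqP; rewrite eq_le sup_dist_ge0 andbT; apply: sup_dist_le => n.
by rewrite subrr normr0 ge_min lexx orbT.
Qed.

Lemma sup_distD x y z : sup_dist x z <= sup_dist x y + sup_dist y z.
Proof.
apply: sup_dist_le => n.
apply: le_trans (lerD (sup_dist_ge x y n) (sup_dist_ge y z n)).
have := ler_distD (y n) (x n) (z n).
have n0 : 0 < n.+1%:R^-1 :> R by rewrite invr_gt0 ltr0n.
have := normr_ge0 (x n - y n); have := normr_ge0 (y n - z n).
move: n0; move: (_^-1) `|_| `|_| `|_| => c p q r c0 q0 r0 pqr.
rewrite /Num.min; case: ifP; case: ifP; case: ifP; lra.
Qed.

Lemma sup_dist_is_metric (X : set {ptws nat -> R}) :
  is_metric (fun x y : X => sup_dist (set_val x) (set_val y)).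
Proof.
split=> [x y|x y|x y|x y z]; [exact: sup_dist_ge0| |exact: sup_distC|exact: sup_distD].
split=> [/sup_dist0P xy|->]; first exact: val_inj.
exact/sup_dist0P.
Qed.

Lemma sup_dist_topology (X : set {ptws nat -> R}) :
  induces_topology (fun x y : X => sup_dist (set_val x) (set_val y)).
Proof.
move=> x A; split=> [/nbhs_cylinderP[N [e [e0 NA]]]|[e e0 eA]].
  exists (Num.min e N.+1%:R^-1); first by rewrite lt_min e0 invr_gt0 ltr0n.
  move=> y /=; rewrite lt_min => /andP[ye yN]; apply: NA => n nN.
  apply: le_lt_trans (sup_dist_coord _) ye; apply: lt_le_trans yN _.
  by rewrite lef_pV2 ?posrE ?ltr0n// ler_nat ltnS ltnW.
have e20 : 0 < e / 2 by rewrite divr_gt0.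
have [N _ NP] := near_infty_natSinv_lt (PosNum e20).
apply/nbhs_cylinderP; exists N, (e / 2); split => // y yN; apply: eA => /=.
apply: (@le_lt_trans _ _ (e / 2)); last by rewrite gtr_pMr// invf_lt1 ?ltr1n.
apply: sup_dist_le => n; rewrite ge_min.
have [nN|Nn] := ltnP n N; first by rewrite (ltW (yN n nN)) orbT.
by rewrite (ltW (NP n Nn)).
Qed.

End SupDistance.

(** * The Polish space of sequences supported on a set *)

Section Supported.
Variables (R : realType) (O : set nat).
Local Open Scope ring_scope.

Definition supported_on : set {ptws nat -> R} :=
  [set x | forall n, ~ O n -> x n = 0].

Definition restrict_to (f : nat -> R) : {ptws nat -> R} :=
  fun n => if `[< O n >] then f n else 0.

Lemma restrict_toP f : supported_on (restrict_to f).
Proof. by move=> n nOn; rewrite /restrict_to asboolF. Qed.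

Definition supported_point (f : nat -> R) : supported_on :=
  SigSub (mem_set (restrict_toP f)).

Lemma supported_pointE f n : O n -> set_val (supported_point f) n = f n.
Proof. by move=> On; rewrite set_valE /= /restrict_to asboolT. Qed.

Lemma supported_eq0 (x : supported_on) n : ~ O n -> set_val x n = 0.
Proof. exact: (set_valP x). Qed.

(** The points with finitely many nonzero values, all of them rational, are
    dense. *)
Lemma supported_separable : separable_space supported_on.
Proof.
pose pt (s : seq rat) := supported_point (fun n => ratr (nth 0 s n)).
exists (range pt); first by apply: card_le_trans (card_image_le _ _) _; exact: countableP.
move=> U [x Ux] oU.
have /nbhs_cylinderP[N [e [e0 NU]]] : nbhs x U by exact: open_nbhs_nbhs.
have /choice[q qP] n : exists r : rat, `|set_val x n - ratr r| < e.
  have [|r] := @rat_in_itvoo _ (set_val x n - e) (set_val x n + e).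
    by rewrite ltrD2l gt0_cp.
  by rewrite in_itv/= -ltr_distl distrC => rx; exists r.
exists (pt (mkseq q N)); split; last by exists (mkseq q N).
apply: NU => n nN; have [On|nOn] := pselect (O n).
  by rewrite supported_pointE// nth_mkseq.
by rewrite !supported_eq0// subrr normr0.
Qed.

Lemma supported_complete :
  is_complete_metric (fun x y : supported_on => sup_dist (set_val x) (set_val y)).
Proof.
move=> u u_cauchy.
have cvgu n : cvg ((fun k => set_val (u k) n) @ \oo).
  (* Below the cut-off 1/(n+1) the distance bounds the difference at n. *)
  apply: cauchy_cvg; apply/cauchy_ballP => e e0.
  have [|N NP] := u_cauchy (Num.min e n.+1%:R^-1).
    by rewrite lt_min e0 invr_gt0 ltr0n.
  pose tail := [set set_val (u k) n | k in [set k | (N <= k)%N]].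
  exists (tail, tail); first by split; exists N => // k Nk; exists k.
  move=> _ [[k /= Nk <-] [m /= Nm <-]]; have := NP k m Nk Nm.
  rewrite lt_min => /andP[ke kn].
  by apply: le_lt_trans (sup_dist_coord kn) ke.
pose x := supported_point (fun n => lim ((fun k => set_val (u k) n) @ \oo)).
have u_x n : (fun k => set_val (u k) n) @ \oo --> set_val x n.
  have [On|nOn] := pselect (O n); first by rewrite supported_pointE.
  rewrite supported_eq0//; under eq_fun do rewrite supported_eq0//.
  exact: cvg_cst.
exists x => A /sup_dist_topology[e e0 eA].
have e20 : 0 < e / 2 by rewrite divr_gt0.
have [N NP] := u_cauchy _ e20; exists N => // k /= Nk; apply: eA => /=.
apply: (@le_lt_trans _ _ (e / 2)); last by rewrite gtr_pMr// invf_lt1 ?ltr1n.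
apply: sup_dist_le => n; apply/ler_addgt0Pr => r r0.
have /cvgrPdist_lt/(_ r r0)[M _ MP] := u_x n.
have {MP} /= MP := MP (maxn M N) (leq_maxl _ _).
have /ltW := NP (maxn M N) k (leq_maxr _ _) Nk.
move=> /(le_trans (sup_dist_ge _ _ n)).
have := ler_distD (set_val (u (maxn M N)) n) (set_val x n) (set_val (u k) n).
move: MP; move: (_^-1) `|_| `|_| `|_| (e / 2) => c p q s t pr pqs.
rewrite /Num.min; case: ifP; case: ifP; lra.
Qed.

Lemma supported_polish : polish_subspace R supported_on.
Proof.
split; first by exists (restrict_to (fun=> 0)); exact: restrict_toP.
split; first exact: supported_separable.
exists (fun x y => sup_dist (set_val x) (set_val y)).
split; [exact: sup_dist_is_metric|exact: sup_dist_topology|exact: supported_complete].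
Qed.

End Supported.
Arguments supported_on R O : clear implicits.

(** * Sequences supported on an infinite orbit *)

Section OrbitSupport.
Variables (R : realType) (G : topologicalGroupType) (a : G -> nat -> nat).
Hypothesis a_fund : fundamental_action a.
Variable n0 : nat.
Hypothesis n0_inf : infinite_set (action_orbit a n0).
Local Open Scope ring_scope.

Let aP : is_left_action a. Proof. by case: a_fund. Qed.
Let O := action_orbit a n0.

Lemma orbit_actP g n : O (a g n) <-> O n.
Proof.
split=> -[h _ hn]; last by exists (g * h)%g; rewrite // aP.2 hn.
by exists (g^-1 * h)%g; rewrite // aP.2 hn (act_invK aP).
Qed.

Lemma orbit_act_eq n : O n -> action_orbit a n = O.
Proof.
move=> [h _ <-]; apply/seteqP; split=> _ [g _ <-].
  by exists (g * h)%g; rewrite // aP.2.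
by exists (g * h^-1)%g; rewrite // aP.2 (act_invK aP).
Qed.

Lemma supported_invariant : invariant_set (bernoulli_shift R a) (supported_on R O).
Proof. by move=> g x xO n nOn; apply: xO => /orbit_actP. Qed.

Let b := sub_action supported_invariant.

(** Let [U] restrict the places below [M] and [V] those below [N].  With [g]
    moving the places of [O] below [M] to [N] or beyond, the two sets of conditions
    on [x] and on its translate by [g] concern different places, so both can be
    met by one point. *)
Lemma shift_transitive (U V : set (supported_on R O)) :
  open U -> open V -> U !=set0 -> V !=set0 -> exists g x, U x /\ V (b g x).
Proof.
move=> oU oV [x Ux] [y Vy].
have /nbhs_cylinderP[M [d [d0 MU]]] : nbhs x U by exact: open_nbhs_nbhs.
have /nbhs_cylinderP[N [e [e0 NV]]] : nbhs y V by exact: open_nbhs_nbhs.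
have [|g gP] := @neumann_separation G nat a
    [seq n <- iota 0 M | `[< O n >]] (iota 0 N) aP.
  by move=> n; rewrite mem_filter => /andP[/asboolP/orbit_act_eq -> _].
have gMN n : O n -> (n < M)%N -> (a g n < N)%N = false.
  move=> On nM; have := gP n.
  rewrite mem_filter asboolT//= !mem_iota !add0n !leq0n nM/=.
  by move=> /(_ isT)/negbTE.
pose z := supported_point O
  (fun n => if (n < M)%N then set_val x n else set_val y (a g n)).
exists g, z; split.
  apply: MU => n nM; have [On|nOn] := pselect (O n).
    by rewrite supported_pointE// nM subrr normr0.
  by rewrite !supported_eq0// subrr normr0.
apply: NV => n nN; have [On|nOn] := pselect (O n); last first.
  by rewrite !supported_eq0// subrr normr0.
have Ogn : O (a g^-1%g n) by apply/orbit_actP.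
rewrite /b sub_shiftE supported_pointE// (act_invKV aP).
case: ifPn => [nM|_]; last by rewrite subrr normr0.
by have := gMN _ Ogn nM; rewrite (act_invKV aP) nN.
Qed.

Lemma shift_generically_ergodic : generically_ergodic b.
Proof.
apply: transitive_generically_ergodic; last exact: shift_transitive.
- exact: sub_shift_action.
- exact: sub_shift_continuous.
- by have [_ /polish_baire] := supported_polish R O.
Qed.

(** A small change of the value at [n0] leads out of the fiber. *)
Lemma coord_fiber_nowhere_dense (c : R) :
  nowhere_dense [set y : supported_on R O | set_val y n0 = c].
Proof.
have On0 : O n0 by exists 1%g; rewrite // aP.1.
apply/nowhere_denseP => U oU [y Uy].
have openN : open [set z : supported_on R O | set_val z n0 != c].
  have cont0 := @value_continuous R (supported_on R O) n0; move/continuousP: cont0.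
  by move=> /(_ [set r | r != c]); apply; exact: open_neq.
exists (U `&` [set z | set_val z n0 != c]); split; [exact: openI| |exact: subIsetl|].
  have [yc|yc] := eqVneq (set_val y n0) c; last by exists y.
  have /nbhs_cylinderP[N [e [e0 NU]]] : nbhs y U by exact: open_nbhs_nbhs.
  pose z := supported_point O (fun n => set_val y n + e / 2).
  exists z; split.
    apply: NU => n _; have [On|nOn] := pselect (O n).
      rewrite supported_pointE// opprD addrA subrr sub0r normrN gtr0_norm ?divr_gt0//.
      by rewrite gtr_pMr// invf_lt1 ?ltr1n.
    by rewrite !supported_eq0// subrr normr0.
  by rewrite /= supported_pointE// yc -subr_eq0 addrAC subrr add0r gt_eqF ?divr_gt0.
by rewrite -subset0 => z [[_ /= /eqP]].
Qed.

(** At the place [n0] the points of the orbit of [x] only take values of [x]. *)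
Lemma shift_meager_orbits : has_meager_orbits b.
Proof.
move=> x; exists (fun k => [set y : supported_on R O | set_val y n0 = set_val x k]).
  by move=> k; exact: coord_fiber_nowhere_dense.
by move=> _ [g _ <-]; exists (a g^-1%g n0).
Qed.

End OrbitSupport.

Theorem mainTheorem5 (R : realType) (G : topologicalGroupType)
    (a : G -> nat -> nat)
    (G_polish : polish R G) (G_nonarch : nonarchimedean G)
    (a_fund : fundamental_action a) :
  ~ compact [set: G] <->
  exists (X : set {ptws nat -> R}) (invX : invariant_set (bernoulli_shift R a) X),
    [/\ polish_subspace R X,
        generically_ergodic (sub_action invX) &
        has_meager_orbits (sub_action invX)].
Proof.
split=> [ncG|[X [invX [pX erg mo]]] cG]; last first.
  exact: (compact_not_generically_ergodic a_fund cG pX mo erg).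
have [n0 n0_inf] : exists n0, infinite_set (action_orbit a n0).
  apply: contrapT => /forallNP fin; apply: ncG.
  by apply: (compact_of_finite_orbits a_fund) => n; exact: contrapT (fin n).
exists (supported_on R (action_orbit a n0)), (@supported_invariant R G a a_fund n0).
split; [exact: supported_polish|exact: shift_generically_ergodic|].
exact: shift_meager_orbits.
Qed.
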